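(* Let $m\geq1$ and $n\geq0$. Then: (a) the map $\rho$ is a poset morphism from $\mathcal{O}(\mathsf{Ca}_{\mathbf{m}})(n)$ to $\mathcal{I}(\mathsf{Ca}_{\mathbf{m}})(n)$; (b) the map $\varphi_4$ sending $u\in\mathbb{N}^n$ to the word of length $n$ whose first letter (if $n\geq1$) is $0$ and with $\varphi_4(u)_i=u_i+i-2$ for $2\leq i\leq n$ is a poset isomorphism from $\mathcal{I}(\mathsf{Ca}_{\mathbf{m}})(n)$ to $\mathcal{B}(\mathsf{Ca}_{\mathbf{m}+\mathbf{1}})(n)$.
   Context: For an integer $m\geq0$, $\mathbf{m}$ is the map on positive integers $\mathbf{m}(i)=(i-1)m$; $\mathbf{m}+\mathbf{1}$ is the map $i\mapsto(i-1)(m+1)$. For such a map $\delta$, a $\delta$-cliff of size $n$ is a word $u=u_1\cdots u_n$ of nonnegative integers with $u_i\leq\delta(i)$ for all $i$. $\mathsf{Ca}_\delta(n)$ is the set of $\delta$-cliffs $u$ of size $n$ ($\delta$-canyons) such that $u_{i-j}\leq u_i-j$ for all $i\in\{1,\dots,n\}$ and all $j\in\{1,\dots,u_i\}$ with $i-j\geq1$. All sets of words of length $n$ are ordered componentwise. Let $\dim_n(\delta):=\#\{i\in\{1,\dots,n\}:\delta(i)\neq0\}$. The set $\mathcal{I}(\mathsf{Ca}_\delta)(n)$ of input-wings consists of the elements of $\mathsf{Ca}_\delta(n)$ covering exactly $\dim_n(\delta)$ elements in the poset $\mathsf{Ca}_\delta(n)$; the set $\mathcal{O}(\mathsf{Ca}_\delta)(n)$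 of output-wings consists of the elements covered by exactly $\dim_n(\delta)$ elements in $\mathsf{Ca}_\delta(n)$; and $\mathcal{B}(\mathsf{Ca}_\delta)(n)=\mathcal{I}(\mathsf{Ca}_\delta)(n)\cap\mathcal{O}(\mathsf{Ca}_\delta)(n)$ is the set of butterflies. These are posets for the componentwise order. The incrementation map $\Uparrow$ sends $\mathbf{m}$-cliffs to $\mathbf{m}$-canyons of the same size and is defined recursively by $\Uparrow(\epsilon)=\epsilon$ for the empty word and $\Uparrow(wa)=\Uparrow(w)\,b$ where $b:=\min\{b\geq a:\Uparrow(w)\,b\text{ is an }\mathbf{m}\text{-canyon}\}$, for $w$ an $\mathbf{m}$-cliff and $a$ a letter such that $wa$ is an $\mathbf{m}$-cliff (such a $b$ always exists for $m\geq1$). For $u\in\mathcal{O}(\mathsf{Ca}_{\mathbf{m}})(n)$, $\rho(u):=\Uparrow(u')$, where $u'$ is the $\mathbf{m}$-cliff obtained from $u$ by incrementing by $1$ all its letters except the first one. A poset morphism is a map $\phi$ such that $x\preccurlyeq y$ implies $\phi(x)\preccurlyeq\phi(y)$; a poset isomorphism is a bijection $\phi$ with $x\preccurlyeq y\iff\phi(x)\preccurlyeq\phi(y)$. *)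

(* Defs.v *)
From mathcomp Require Import all_boot all_order.
From mathcomp Require Import boolp classical_sets functions cardinality.

Set Implicit Arguments.
Unset Strict Implicit.
Unset Printing Implicit Defensive.

Local Open Scope order_scope.
Local Open Scope classical_set_scope.
Local Open Scope card_scope.
Local Open Scope nat_scope.

(* In [covers A x y] it is x, the larger element, that covers y; A carries the
   order induced from T. *)
Definition covers d (T : porderType d) (A : set T) (x y : T) : Prop :=
  [/\ A x, A y, (y < x)%O &
      ~ exists z, [/\ A z, (y < z)%O & (z < x)%O]].

Definition poset_morphism d (T : porderType d) (A B : set T) (f : T -> T) :
    Prop :=
  set_fun A B f /\
  forall x y, A x -> A y -> (x <= y)%O -> (f x <= f y)%O.

Definition poset_isomorphism d (T : porderType d) (A B : set T) (f : T -> T) :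
    Prop :=
  set_bij A B f /\
  forall x y, A x -> A y -> (x <= y)%O <-> (f x <= f y)%O.

(* [n.-tupleprod nat] is [n.-tuple nat] with the componentwise order. *)
Notation word n := (n.-tupleprod nat).

(* Positions of letters, and the arguments of range maps, start at 1. *)
Definition letter (u : seq nat) (i : nat) : nat := nth 0 u i.-1.

Definition bold (m i : nat) : nat := i.-1 * m.

Definition cliff (delta : nat -> nat) (u : seq nat) : bool :=
  all (fun i => letter u i <= delta i) (iota 1 (size u)).

(* The truncated subtractions are harmless: j <= u_i, and [0 < i - j] is
   j < i. *)
Definition canyon (delta : nat -> nat) (u : seq nat) : bool :=
  cliff delta u &&
  all (fun i =>
         all (fun j => (0 < i - j) ==> (letter u (i - j) <= letter u i - j))
             (iota 1 (letter u i)))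
      (iota 1 (size u)).

Definition Ca (delta : nat -> nat) (n : nat) : set (word n) :=
  [set u | canyon delta u].
Arguments Ca : clear implicits.

Definition dim (delta : nat -> nat) (n : nat) : nat :=
  count (fun i => delta i != 0) (iota 1 n).

Definition input_wings (delta : nat -> nat) (n : nat) : set (word n) :=
  [set u | Ca delta n u /\
           [set v | covers (Ca delta n) u v] #= `I_(dim delta n)].

Definition output_wings (delta : nat -> nat) (n : nat) : set (word n) :=
  [set u | Ca delta n u /\
           [set v | covers (Ca delta n) v u] #= `I_(dim delta n)].
Arguments input_wings : clear implicits.
Arguments output_wings : clear implicits.

Definition butterflies (delta : nat -> nat) (n : nat) : set (word n) :=
  input_wings delta n `&` output_wings delta n.
Arguments butterflies : clear implicits.

(* The least b >= a such that v b is a canyon.  If there is none, the value is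
   a: then v a is not a canyon, and neither is any word starting with v a. *)
Definition next_letter (m : nat) (v : seq nat) (a : nat) : nat :=
  if pselect (exists b, (a <= b) && canyon (bold m) (rcons v b)) is left exb
  then ex_minn exb else a.

(* Reading a word from left to right amounts to the recursion
   incr (w a) = incr(w) b on its last letter. *)
Definition incr (m : nat) (w : seq nat) : seq nat :=
  foldl (fun v a => rcons v (next_letter m v a)) [::] w.

Lemma incr_nil m : incr m [::] = [::].
Proof. by []. Qed.

Lemma incr_rcons m w a :
  incr m (rcons w a) = rcons (incr m w) (next_letter m (incr m w) a).
Proof. by rewrite /incr -cats1 foldl_cat. Qed.

Lemma size_incr m w : size (incr m w) = size w.
Proof. by elim/last_ind: w => // w a IH; rewrite incr_rcons !size_rcons IH. Qed.

Lemma size_incr_tuple m n (w : n.-tuple nat) : size (incr m w) == n.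
Proof. by rewrite size_incr size_tuple. Qed.

Definition Incr (m n : nat) (w : word n) : word n :=
  Tuple (size_incr_tuple m w).

(* In [tnth u i] the index i : 'I_n starts at 0, so it is the letter at
   position i.+1. *)
Definition bump_tail (n : nat) (u : word n) : word n :=
  [tuple if i == 0 :> nat then tnth u i else (tnth u i).+1 | i < n].

Definition rho (m n : nat) (u : word n) : word n := Incr m (bump_tail u).

Definition phi4 (n : nat) (u : word n) : word n :=
  [tuple if i == 0 :> nat then 0 else tnth u i + i.+1 - 2 | i < n].
Arguments rho : clear implicits.
Arguments phi4 : clear implicits.

(* Main.v *)
Require Import Defs.
From mathcomp Require Import all_boot all_order.
From mathcomp Require Import boolp classical_sets functions cardinality.
From mathcomp Require Import zify.

(** Number the letters of a word from 0, so that the range map is i * m.  A word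
    u is a canyon when u_i <= i * m and, for k < i, the letter u_i is either
    smaller than i - k or at least u_k + (i - k).  With d_i := i - u_i, this says
    that the intervals (d_i, i] are pairwise disjoint or nested, as for the
    bracket vectors of the Tamari lattice.  The counting definitions of
    the wings become conditions on single letters, as follows.

    Going down.  Lowering one letter only shrinks its interval, so the letters to
    its right impose no condition; and at the first position where a smaller
    canyon v differs from u, the letter of v is compatible with the prefix of u.
    So a canyon covered by u differs from u in exactly one position, which
    determines it, and position i contributes a covered element exactly when
    u_i > 0.  Input-wings are thus the canyons all of whose letters but the first
    are positive ([input_wingsP]).  Positivity forces u_i >= u_(i-1) + 1, hence
    these are the strictly increasing cliffs ([input_wings_increasingP]).

    Going up.  Canyons are stable under letterwise minimum ([Ca_meet]), so two
    distinct covers of u cannot raise a common letter: the sets of raised letters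
    of the covers are disjoint and nonempty.  At most n - 1 letters can be
    raised, so if there are n - 1 covers, these sets are the n - 1 singletons.
    Output-wings are thus the canyons in which each letter but the first can be
    raised alone ([output_wingsP]).  For a strictly increasing word this means
    that u_i < i * m for i > 0 and that consecutive letters after the first differ by at
    least 2 ([butterfliesP]).

    Both directions share the same counting argument
    ([card_eq_II_transversal]): if every element of a set carries some of k
    labels and no two elements share a label, the set has k elements exactly
    when each label is the only label of some element.

    Part (a).  The incrementation of a cliff w is the least canyon above w
    ([incrP]), so it is monotone.  In an output-wing u_i < i * m for i > 0, so the
    word with incremented letters is a cliff with positive letters, and the
    canyon above it is an input-wing.

    Part (b).  In terms of increasing words, the map adds i - 1 to the letter of
    index i > 0; it turns the steps u_i >= u_(i-1) + 1 into steps of at least 2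
    and the bound i * m into i * (m + 1) - 1, and is visibly invertible. *)

Set Implicit Arguments.
Unset Strict Implicit.
Unset Printing Implicit Defensive.

Import Order.TTheory.
Local Open Scope classical_set_scope.
Local Open Scope card_scope.
Local Open Scope nat_scope.

Local Notation "u `_ i" := (nth 0 (@tval _ nat u) i) : nat_scope.

(** * Sets of k elements separated by k labels *)

Lemma card_eq_II_injP T (C : set T) (g : T -> nat) k :
    (forall c, C c -> g c < k) -> {in C &, injective g} ->
  C #= `I_k <-> g @` C = `I_k.
Proof.
move=> gk g_inj; split=> [Ck|gC]; last first.
  by rewrite -gC card_eq_sym; apply: inj_card_eq.
rewrite eqEsubset; split=> [_ [c Cc <-]|i /= ik]; first exact: gk.
apply: contrapT => gNi.
(* If i is missed, giving the label i to the element labelled k - 1 injects C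
   into `I_(k - 1). *)
pose h c := if g c == k.-1 then i else g c.
have h_inj : {in C &, injective h}.
  move=> c c' cC c'C; rewrite /h.
  have Ngi d : d \in C -> g d <> i by move=> /set_mem Cd gd; apply: gNi; exists d.
  case: eqP => [gc|_]; case: eqP => [gc'|_] eqg.
  - by apply: g_inj => //; rewrite gc gc'.
  - by case: (Ngi c').
  - by case: (Ngi c).
  - exact: g_inj.
have hC : h @` C `<=` `I_k.-1.
  move=> _ [c Cc <-] /=; rewrite /h; case: eqP => [gc|gc].
    suff : i <> k.-1 by lia.
    by move=> ik1; apply: gNi; exists c; rewrite // ik1.
  by have := gk _ Cc; lia.
have : `I_k #<= `I_k.-1.
  apply: card_le_trans (subset_card_le hC).
  have := card_eq_trans (inj_card_eq h_inj) Ck.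
  by rewrite card_eq_le => /andP[].
by rewrite card_le_II; lia.
Qed.

(** An element may carry several labels, but no label is shared.  Choosing a label
    for each element gives an injection into `I_k; when C has k elements every
    such choice is a bijection, and this leaves room for only one label each. *)
Lemma card_eq_II_transversal T (C : set T) (D : T -> nat -> Prop) k :
    (forall c, C c -> exists2 i, i < k & D c i) ->
    (forall c c' i, C c -> C c' -> i < k -> D c i -> D c' i -> c = c') ->
  C #= `I_k <->
  forall i, i < k -> exists2 c, C c & forall j, j < k -> D c j <-> j = i.
Proof.
move=> Dex Dinj.
have [|g gP] := @choice T nat (fun c i => C c -> i < k /\ D c i).
  move=> c; have [/Dex[i ik Dci]|nCc] := pselect (C c); first by exists i.
  by exists 0.
have g_inj : {in C &, injective g}.
  move=> c c' /set_mem Cc /set_mem Cc' gcc'.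
  have [gk Dc] := gP _ Cc; have [_] := gP _ Cc'; rewrite -gcc'.
  exact: Dinj Dc.
rewrite (@card_eq_II_injP _ _ g) //; last by move=> c /gP[].
split=> [gC i ik|ex].
  have [c Cc gc] : (g @` C) i by rewrite gC.
  exists c => // j jk; split=> [Dcj|->]; last by rewrite -gc; case: (gP c).
  have [c' Cc' gc'] : (g @` C) j by rewrite gC.
  have [_] := gP _ Cc'; rewrite gc' => Dc'j.
  by rewrite -gc -gc' (Dinj c c' j).
rewrite eqEsubset; split=> [_ [c Cc <-]|i /= ik]; first by case: (gP c).
have [c Cc Dc] := ex i ik; exists c => //.
by have [gk Dg] := gP _ Cc; apply/Dc.
Qed.

(** * Words and their letters *)

Lemma word_eqP n (u v : word n) : (forall i, i < n -> u`_i = v`_i) <-> u = v.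
Proof.
split=> [uv|-> //]; apply/val_inj/(@eq_from_nth _ 0) => [|i].
  by rewrite !size_tuple.
by rewrite size_tuple => /uv.
Qed.

Lemma word_leP n (u v : word n) :
  reflect (forall i, i < n -> u`_i <= v`_i) (u <= v)%O.
Proof.
rewrite leEtprod; apply: (iffP forallP) => [uv i ni|uv i].
  by have := uv (Ordinal ni); rewrite !(tnth_nth 0).
by rewrite !(tnth_nth 0); apply: uv.
Qed.

Lemma word_lt_letter n (u v : word n) :
  (u < v)%O -> exists2 i, i < n & u`_i < v`_i.
Proof.
move=> uv; apply: contrapT => nex.
move: uv; rewrite lt_leAnge => /andP[_ /negP]; apply; apply/word_leP => i ni.
by rewrite leqNgt; apply/negP => lt; apply: nex; exists i.
Qed.

Definition replace n (u : word n) (i a : nat) : word n :=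
  [tuple if j == i :> nat then a else tnth u j | j < n].

Lemma nth_mkword n (f : 'I_n -> nat) i (ni : i < n) :
  [tuple f j | j < n]`_i = f (Ordinal ni).
Proof. by rewrite -(tnth_nth 0 _ (Ordinal ni)) tnth_mktuple. Qed.

Lemma nth_replace n (u : word n) i a j : j < n ->
  (replace u i a)`_j = if j == i then a else u`_j.
Proof. by move=> nj; rewrite nth_mkword (tnth_nth 0). Qed.

Lemma replace_id n (u : word n) i : replace u i u`_i = u.
Proof. by apply/word_eqP => j nj; rewrite nth_replace //; case: eqP => [->|]. Qed.

Lemma replace_lt n (u : word n) i a b : i < n ->
  (replace u i a < replace u i b)%O = (a < b).
Proof.
move=> ni; rewrite lt_leAnge.
have le x y : (replace u i x <= replace u i y)%O = (x <= y).
  apply/word_leP/idP => [/(_ i ni)|xy j nj].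
    by rewrite !nth_replace // eqxx.
  by rewrite !nth_replace //; case: eqP.
by rewrite !le; lia.
Qed.

Lemma nth_meet n (u v : word n) i : i < n ->
  (u `&` v)%O`_i = minn u`_i v`_i.
Proof.
by move=> ni; rewrite Order.TupleProdOrder.meetEtprod nth_mkword !(tnth_nth 0).
Qed.

(** * Canyons *)

Lemma canyonP m (u : seq nat) :
  reflect ((forall i, i < size u -> nth 0 u i <= i * m) /\
           forall k i, k < i < size u -> i - k <= nth 0 u i ->
             nth 0 u k + (i - k) <= nth 0 u i)
          (canyon (bold m) u).
Proof.
apply: (iffP andP) => [[/allP cl /allP can]|[cl can]]; split.
- move=> i iu; have := cl i.+1; rewrite mem_iota /letter /bold /=; apply; lia.
- move=> k i /andP[ki iu] iku.
  have /allP := can i.+1 ltac:(by rewrite mem_iota; lia).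
  rewrite /letter /= => /(_ (i - k)); rewrite mem_iota.
  have -> : (i.+1 - (i - k)).-1 = k by lia.
  by move=> /(_ ltac:(lia)) /implyP /(_ ltac:(lia)); lia.
- apply/allP => i; rewrite mem_iota /letter /bold => ?; apply: cl; lia.
- apply/allP => i; rewrite mem_iota => ?; apply/allP => j.
  rewrite mem_iota /letter => ?; apply/implyP => ?.
  have := can (i - j).-1 i.-1 ltac:(lia).
  have -> : i.-1 - (i - j).-1 = j by lia.
  by move=> /(_ ltac:(lia)); lia.
Qed.

Lemma CaP m n (u : word n) :
  Ca (bold m) n u <->
  (forall i, i < n -> u`_i <= i * m) /\
  forall k i, k < i < n -> i - k <= u`_i -> u`_k + (i - k) <= u`_i.
Proof. by split=> [/canyonP|?]; last apply/canyonP; rewrite size_tuple. Qed.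

Lemma Ca_head m n (u : word n) : Ca (bold m) n u -> u`_0 = 0.
Proof.
move=> /CaP[cl _]; have [n0|n0] := ltnP 0 n; first by have := cl _ n0; lia.
by rewrite nth_default ?size_tuple.
Qed.

(** The interval (i - u_i, i] of a letterwise minimum is the intersection of the
    two intervals, and nestedness passes to intersections. *)
Lemma Ca_meet m n (u v : word n) :
  Ca (bold m) n u -> Ca (bold m) n v -> Ca (bold m) n (u `&` v)%O.
Proof.
move=> /CaP[clu cau] /CaP[clv cav].
apply/CaP; split=> [i ni|k i kin].
  by rewrite nth_meet // geq_min clu.
rewrite !nth_meet; [|lia..].
have := cau _ _ kin; have := cav _ _ kin; lia.
Qed.

(** Only the letters to the left of i constrain the new letter a: decreasing u_i
    weakens the conditions that it imposes on the letters to its right. *)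
Lemma Ca_lower_letter m n (u : word n) i a : i < n -> Ca (bold m) n u ->
    a <= u`_i -> (forall k, k < i -> i - k <= a -> u`_k + (i - k) <= a) ->
  Ca (bold m) n (replace u i a).
Proof.
move=> ni /CaP[clu cau] au aP.
apply/CaP; split=> [j nj|k j kj].
  rewrite nth_replace //; case: eqP => [->|_]; last exact: clu.
  exact: leq_trans au (clu i ni).
rewrite !nth_replace; [|lia..].
case: (j =P i) => [ji|ji]; case: (k =P i) => [ki|ki]; [lia| | |].
- by subst j; apply: aP; lia.
- by subst k => jiu; have := cau i j kj jiu; lia.
- exact: cau.
Qed.

(** A positive u_(i+1) is at least 1, the distance to its left neighbour, so the
    canyon condition for this pair applies and gives u_(i+1) >= u_i + 1. *)
Lemma Ca_increasingP m n (u : word n) :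
  (Ca (bold m) n u /\ forall i, i.+1 < n -> 0 < u`_i.+1) <->
  (forall i, i < n -> u`_i <= i * m) /\ forall i, i.+1 < n -> u`_i < u`_i.+1.
Proof.
split=> [[/CaP[cl ca] pos]|[cl inc]].
  split=> // i ni.
  by have := ca i i.+1 ltac:(lia); have := pos i ni; lia.
split=> [|i ni]; last by have := inc i ni; lia.
apply/CaP; split=> // k i /andP[ki ni] _.
elim: i ki ni => // i IH; rewrite ltnS leq_eqVlt => /orP[/eqP <-|ki] ni.
  by have := inc k ni; lia.
by have := IH ki ltac:(lia); have := inc i ni; lia.
Qed.

(** * Covers differing in one letter *)

(** Let j be the first position where v differs from u.  Replacing u_j by v_j
    gives a canyon between v and u, hence equal to v. *)
Lemma lower_covers_letter m n (u v : word n) i : i < n ->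
  covers (Ca (bold m) n) u v -> v`_i <> u`_i ->
  v = replace u i v`_i /\ v`_i < u`_i.
Proof.
move=> ni [Cu Cv vu nbtw] vui.
have le : forall j, j < n -> v`_j <= u`_j by apply/word_leP/ltW.
pose P j := (j < n) && (v`_j < u`_j).
have exP : exists j, P j by have [j nj ?] := word_lt_letter vu; exists j; apply/andP.
case: (ex_minnP exP) => j /andP[nj vuj] minj.
have vE : v = replace u j v`_j.
  apply: contrapT => /eqP vN; apply: nbtw; exists (replace u j v`_j); split.
  - apply: Ca_lower_letter => // [|k kj]; first exact: ltnW.
    have -> : u`_k = v`_k by have := le k; have := minj k; rewrite /P; lia.
    by case/CaP: Cv => _; apply; rewrite kj.
  - rewrite lt_neqAle vN; apply/word_leP => k nk; rewrite nth_replace //.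
    by case: eqP => [->//|_]; exact: le.
  - rewrite lt_neqAle; apply/andP; split.
      apply/eqP => /(congr1 (fun w : word n => w`_j)).
      by rewrite nth_replace // eqxx; lia.
    apply/word_leP => k nk; rewrite nth_replace //.
    by case: eqP => [->|//]; exact: ltnW.
have ij : i = j.
  by apply: contrapT => /eqP ij; apply: vui; rewrite vE nth_replace // (negbTE ij).
by subst j.
Qed.

(** A word between two words that differ only at i can differ from them only
    at i. *)
Lemma covers_replace m n (u : word n) i a b : i < n -> a < b ->
    Ca (bold m) n (replace u i a) -> Ca (bold m) n (replace u i b) ->
    (forall c, a < c < b -> ~ Ca (bold m) n (replace u i c)) ->
  covers (Ca (bold m) n) (replace u i b) (replace u i a).
Proof.
move=> ni ab Ca_a Ca_b gap; split=> //; first by rewrite replace_lt.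
case=> z [Cz az zb].
have zE : z = replace u i z`_i.
  apply/word_eqP => j nj; rewrite nth_replace //; case: eqP => [->//|ij].
  have := ltW az => /word_leP/(_ j nj); have := ltW zb => /word_leP/(_ j nj).
  by rewrite !nth_replace //; case: eqP => // _; lia.
move: az zb; rewrite zE !replace_lt // => az zb.
by apply: (gap z`_i); rewrite -?zE // az.
Qed.

Lemma cover_above_letter m n (u : word n) i a : i < n -> u`_i < a ->
    Ca (bold m) n u -> Ca (bold m) n (replace u i a) ->
  exists2 b, u`_i < b & covers (Ca (bold m) n) (replace u i b) u.
Proof.
move=> ni ua Cu Caa.
pose P b := (u`_i < b) && canyon (bold m) (replace u i b).
have exP : exists b, P b by exists a; rewrite /P ua.
case: (ex_minnP exP) => b /andP[ub Cb] minb; exists b => //.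
rewrite -{2}(replace_id u i); apply: covers_replace; rewrite ?replace_id //.
move=> c /andP[uc cb] Cc; have := minb c; rewrite /P uc Cc /=; lia.
Qed.

Lemma cover_below_letter m n (u : word n) i a : i < n -> a < u`_i ->
    Ca (bold m) n u -> Ca (bold m) n (replace u i a) ->
  exists2 b, b < u`_i & covers (Ca (bold m) n) u (replace u i b).
Proof.
move=> ni au Cu Caa.
pose P b := (b < u`_i) && canyon (bold m) (replace u i b).
have exP : exists b, P b by exists a; rewrite /P au.
have ubP b : P b -> b <= u`_i by case/andP=> /ltnW.
case: (ex_maxnP exP ubP) => b /andP[bu Cb] maxb; exists b => //.
rewrite -{1}(replace_id u i); apply: covers_replace; rewrite ?replace_id //.
move=> c /andP[bc cu] Cc; have := maxb c; rewrite /P cu Cc /=; lia.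
Qed.

Lemma Ca_lt_tail m n (u v : word n) : Ca (bold m) n u -> Ca (bold m) n v ->
  (u < v)%O -> exists2 i, i < n.-1 & u`_i.+1 < v`_i.+1.
Proof.
move=> /Ca_head u0 /Ca_head v0 /word_lt_letter[[|i] ni]; first by rewrite u0 v0.
by exists i => //; lia.
Qed.

(** * Wings *)

Lemma dim_bold m n : 0 < m -> dim (bold m) n = n.-1.
Proof.
move=> m0; case: n => // n; rewrite /dim /= add0n (eq_in_count (a2 := predT)).
  by rewrite count_predT size_iota.
by move=> i; rewrite mem_iota /bold -lt0n muln_gt0 => /andP[i1 _] /=; lia.
Qed.

(** The label i of a cover stands for a difference at position i + 1; the letter
    at position 0 of a canyon is always 0 and cannot change.  Two lower covers
    sharing a label are u with the same letter replaced, so they are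
    comparable. *)
Lemma input_wings_transversal m n (u : word n) : 0 < m ->
  input_wings (bold m) n u <->
  Ca (bold m) n u /\
  forall i, i < n.-1 -> exists2 v, covers (Ca (bold m) n) u v &
    forall j, j < n.-1 -> v`_j.+1 <> u`_j.+1 <-> j = i.
Proof.
move=> m0; rewrite /input_wings /= dim_bold // -card_eq_II_transversal //.
  move=> v [Cu Cv vu _]; have [i ni lt] := Ca_lt_tail Cv Cu vu.
  by exists i => //; lia.
move=> v w i; wlog: v w / v`_i.+1 <= w`_i.+1 => [IH|vw] cv cw ni vi wi.
  have /orP[vw|wv] := leq_total v`_i.+1 w`_i.+1; first exact: IH.
  by apply/esym; apply: IH.
have {}ni : i.+1 < n by lia.
have [vE _] := lower_covers_letter ni cv vi.
have [wE _] := lower_covers_letter ni cw wi.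
apply: contrapT => vNw.
case: cv => _ _ _; apply; exists w; case: cw => _ Cw wu _; split=> //.
rewrite vE wE replace_lt // ltn_neqAle vw andbT; apply/eqP => eq.
by apply: vNw; rewrite vE wE eq.
Qed.

(** If two upper covers of u raise the same letter, their letterwise minimum is a
    canyon that is still strictly above u, so it equals both of them. *)
Lemma output_wings_transversal m n (u : word n) : 0 < m ->
  output_wings (bold m) n u <->
  Ca (bold m) n u /\
  forall i, i < n.-1 -> exists2 v, covers (Ca (bold m) n) v u &
    forall j, j < n.-1 -> v`_j.+1 <> u`_j.+1 <-> j = i.
Proof.
move=> m0; rewrite /output_wings /= dim_bold // -card_eq_II_transversal //.
  move=> v [Cv Cu uv _]; have [i ni lt] := Ca_lt_tail Cu Cv uv.
  by exists i => //; lia.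
move=> v w i [Cv Cu uv nv] [Cw _ uw nw] ni vi wi.
have {}ni : i.+1 < n by lia.
have u_meet : (u < v `&` w)%O.
  rewrite lt_neqAle lexI !ltW // !andbT; apply/eqP => eq.
  have := nth_meet v w ni; rewrite -eq.
  have /word_leP/(_ _ ni) := ltW uv; have /word_leP/(_ _ ni) := ltW uw; lia.
have meetE x : (v `&` w <= x)%O -> covers (Ca (bold m) n) x u -> (v `&` w)%O = x.
  move=> le [_ _ _ nx]; apply: contrapT => /eqP neq; apply: nx.
  by exists (v `&` w)%O; split; [exact: Ca_meet | | rewrite lt_neqAle neq].
have cv : covers (Ca (bold m) n) v u by [].
have cw : covers (Ca (bold m) n) w u by [].
by transitivity (v `&` w)%O; [apply/esym|]; apply: meetE; rewrite ?leIl ?leIr.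
Qed.

Lemma input_wingsP m n (u : word n) : 0 < m ->
  input_wings (bold m) n u <->
  Ca (bold m) n u /\ forall i, i.+1 < n -> 0 < u`_i.+1.
Proof.
move=> m0; rewrite input_wings_transversal //; split=> -[Cu H]; split=> // i ni.
  have [v cv Dv] := H i ltac:(lia).
  have vi : v`_i.+1 <> u`_i.+1 by apply/Dv => //; lia.
  by have [_] := lower_covers_letter ni cv vi; lia.
have ni' : i.+1 < n by lia.
have C0 : Ca (bold m) n (replace u i.+1 0) by apply: Ca_lower_letter => // k; lia.
have [b bu cb] := cover_below_letter ni' (H i ni') Cu C0.
exists (replace u i.+1 b) => // j nj; rewrite nth_replace; last by lia.
by rewrite eqSS; case: eqP => [->|]; lia.
Qed.

Lemma input_wings_increasingP m n (u : word n) : 0 < m ->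
  input_wings (bold m) n u <->
  (forall i, i < n -> u`_i <= i * m) /\ forall i, i.+1 < n -> u`_i < u`_i.+1.
Proof. by move=> m0; rewrite input_wingsP // Ca_increasingP. Qed.

Lemma output_wingsP m n (u : word n) : 0 < m ->
  output_wings (bold m) n u <->
  Ca (bold m) n u /\ forall i, i.+1 < n ->
    exists2 a, u`_i.+1 < a & Ca (bold m) n (replace u i.+1 a).
Proof.
move=> m0; rewrite output_wings_transversal //; split=> -[Cu H]; split=> // i ni.
  have [v [Cv _ uv _] Dv] := H i ltac:(lia).
  have vi : v`_i.+1 <> u`_i.+1 by apply/Dv => //; lia.
  exists v`_i.+1.
    by have /word_leP/(_ i.+1 ni) := ltW uv; lia.
  suff <- : v = replace u i.+1 v`_i.+1 by [].
  apply/word_eqP => -[|j] nj; rewrite nth_replace //=; last first.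
    rewrite eqSS; case: eqP => [->//|ij].
    by apply: contrapT => /Dv; apply: contra_not ij; apply; lia.
  by rewrite (Ca_head Cu) (Ca_head Cv).
have ni' : i.+1 < n by lia.
have [a ua Caa] := H i ni'.
have [b ub cb] := cover_above_letter ni' ua Cu Caa.
exists (replace u i.+1 b) => // j nj; rewrite nth_replace; last by lia.
by rewrite eqSS; case: eqP => [->|]; lia.
Qed.

Lemma output_wings_lt m n (u : word n) : 0 < m -> output_wings (bold m) n u ->
  forall i, i.+1 < n -> u`_i.+1 < i.+1 * m.
Proof.
move=> m0 /(output_wingsP _ m0)[_ H] i ni; have [a ua /CaP[+ _]] := H i ni.
by move=> /(_ _ ni); rewrite nth_replace // eqxx; lia.
Qed.

(** The gap of 2 comes from the output side: in an increasing word, raising u_i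
    alone requires room for one more value below u_(i+1).  The gaps start at
    position 1 because the letter at position 0 cannot be raised. *)
Lemma butterfliesP m n (v : word n) : 0 < m ->
  butterflies (bold m) n v <->
  [/\ v`_0 = 0, forall i, i.+1 < n -> 0 < v`_i.+1 < i.+1 * m &
      forall i, i.+2 < n -> v`_i.+1 + 2 <= v`_i.+2].
Proof.
move=> m0; split=> [[/(input_wingsP _ m0) I Ov]|[v0 bd gap]].
  have [Cv pos] := I; have [_ inc] := (Ca_increasingP _ _).1 I.
  split=> [|i ni|i ni]; first exact: Ca_head Cv.
    by rewrite pos // (output_wings_lt m0 Ov).
  have [_ /(_ i ltac:(lia)) [a va]] := (output_wingsP _ m0).1 Ov.
  move=> /CaP[_ /(_ i.+1 i.+2)]; rewrite !nth_replace; [|lia..].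
  rewrite eqxx (_ : i.+2 == i.+1 = false); last by lia.
  by have := inc i.+1 ni; lia.
have I : Ca (bold m) n v /\ forall i, i.+1 < n -> 0 < v`_i.+1.
  apply/Ca_increasingP; split=> [[|i] ni|[|i] ni]; rewrite ?v0 //.
  - by have := bd i ni; lia.
  - by have := bd 0 ni; lia.
  - by have := gap i ni; lia.
split; first by apply/input_wingsP.
apply/output_wingsP => //; split=> [|i ni]; first by case: I.
exists (v`_i.+1).+1 => //.
apply: (proj1 ((Ca_increasingP m (replace v i.+1 (v`_i.+1).+1)).2 _)).
have [cl inc] := (Ca_increasingP _ _).1 I.
split=> j nj.
  rewrite nth_replace //.
  by case: eqP => [->|_]; [have := bd i ni; lia | exact: cl].
rewrite !nth_replace //; last exact: ltnW.
rewrite eqSS; case: (j =P i) => [->|_]; case: eqP => [ji|_]; [lia| | |].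
- by have := inc i ni; lia.
- by move: nj; rewrite ji => /gap; lia.
- exact: inc.
Qed.

(** * The incrementation map *)

Lemma canyon_rconsP m (w : seq nat) b :
  canyon (bold m) (rcons w b) <->
  [/\ canyon (bold m) w, b <= size w * m &
      forall k, k < size w -> size w - k <= b -> nth 0 w k + (size w - k) <= b].
Proof.
split=> [/canyonP[]|[/canyonP[clw caw] bm bP]].
  rewrite size_rcons => cl ca.
  split; first apply/canyonP; try split.
  - by move=> i iw; have := cl i ltac:(lia); rewrite nth_rcons iw.
  - move=> k i kiw; have := ca k i ltac:(lia); rewrite !nth_rcons.
    by have /andP[-> ->] : (k < size w) && (i < size w) by lia.
  - by have := cl (size w) ltac:(lia); rewrite nth_rcons ltnn eqxx.
  - move=> k kw; have := ca k (size w) ltac:(lia).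
    by rewrite !nth_rcons kw ltnn eqxx.
apply/canyonP; rewrite size_rcons; split=> [i iw|k i kiw].
  by rewrite nth_rcons; case: (ltngtP i (size w)) => [/clw||->].
rewrite !nth_rcons; have -> : k < size w by lia.
case: (ltngtP i (size w)) => [?|?|->]; [by apply: caw; lia | lia |].
by apply: bP; lia.
Qed.

Lemma next_letterP m (w : seq nat) a : 0 < m -> canyon (bold m) w ->
    a <= size w * m ->
  [/\ a <= next_letter m w a, canyon (bold m) (rcons w (next_letter m w a)) &
      forall b, a <= b -> canyon (bold m) (rcons w b) -> next_letter m w a <= b].
Proof.
move=> m0 Cw am; rewrite /next_letter; case: pselect => [exb|[]].
  case: ex_minnP => b /andP[ab Cb] minb; split=> // c ac Cc.
  by apply: minb; rewrite ac.
(* The maximal letter always extends a canyon: for k < size w it is at least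
   k * m + (size w - k) since m > 0. *)
exists (size w * m); rewrite am; apply/canyon_rconsP; split=> // k kw _.
have /canyonP[/(_ k kw) clk _] := Cw.
have : size w - k <= (size w - k) * m by rewrite leq_pmulr.
by rewrite mulnBl; have := leq_mul2r m k (size w); lia.
Qed.

(** Minimality is what makes the incrementation monotone: a canyon above w has
    prefixes above those of incr m w, hence stronger constraints on its next
    letter, so the greedy choice of each letter stays below it. *)
Lemma incrP m (w : seq nat) : 0 < m ->
    (forall i, i < size w -> nth 0 w i <= i * m) ->
  [/\ canyon (bold m) (incr m w), forall i, nth 0 w i <= nth 0 (incr m w) i &
      forall y, size y = size w -> canyon (bold m) y ->
        (forall i, nth 0 w i <= nth 0 y i) ->
        forall i, nth 0 (incr m w) i <= nth 0 y i].
Proof.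
move=> m0; elim/last_ind: w => [|w a IH] clw.
  by split=> // y _ _ _ i; rewrite nth_nil.
have clw' i : i < size w -> nth 0 w i <= i * m.
  by move=> iw; have := clw i; rewrite size_rcons nth_rcons iw; apply; lia.
have [Cw w_le least] := IH clw'.
have am : a <= size (incr m w) * m.
  have := clw (size w); rewrite size_rcons nth_rcons ltnn eqxx size_incr.
  by apply; lia.
have [ab Cb minb] := next_letterP m0 Cw am.
rewrite incr_rcons; split=> // [i|y].
  by rewrite !nth_rcons size_incr; case: ltngtP.
case/lastP: y => [|y b]; rewrite !size_rcons // => -[sz] Cyb le i.
have [Cy bm bP] := (canyon_rconsP _ _ _).1 Cyb.
have {}least : forall i, nth 0 (incr m w) i <= nth 0 y i.
  apply: least => // j; have [jw|jw] := ltnP j (size w).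
    by have := le j; rewrite !nth_rcons sz jw.
  by rewrite nth_default.
rewrite !nth_rcons size_incr sz; case: ltngtP => // iw.
apply: minb.
  by have := le (size w); rewrite !nth_rcons sz ltnn eqxx.
apply/canyon_rconsP; rewrite size_incr -sz; split=> // k ky kb.
by have := bP k ky kb; have := least k; lia.
Qed.

(** * The two maps *)

Lemma nth_bump_tail n (u : word n) i : i < n ->
  (bump_tail u)`_i = (i != 0) + u`_i.
Proof. by move=> ni; rewrite nth_mkword (tnth_nth 0) /=; case: eqP. Qed.

Lemma nth_phi4 n (u : word n) i : i < n ->
  (phi4 n u)`_i = if i == 0 then 0 else u`_i + i - 1.
Proof. by move=> ni; rewrite nth_mkword (tnth_nth 0) /=; case: eqP; lia. Qed.

Lemma bump_tail_cliff m n (u : word n) : 0 < m -> output_wings (bold m) n u ->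
  forall i, i < n -> (bump_tail u)`_i <= i * m.
Proof.
move=> m0 Ou [|i] ni; rewrite nth_bump_tail //=.
  by case: Ou => /Ca_head ->.
exact: output_wings_lt.
Qed.

Lemma rhoP m n (u : word n) : 0 < m -> output_wings (bold m) n u ->
  [/\ Ca (bold m) n (rho m n u), (bump_tail u <= rho m n u)%O &
      forall y : word n, Ca (bold m) n y -> (bump_tail u <= y)%O ->
        (rho m n u <= y)%O].
Proof.
move=> m0 Ou; have [|C le least] := @incrP m (bump_tail u) m0.
  by move=> i; rewrite size_tuple; apply: bump_tail_cliff.
split=> // [|y Cy /word_leP uy]; first by apply/word_leP => i _; apply: le.
apply/word_leP => i _; apply: least; rewrite ?size_tuple // => j.
have [nj|nj] := ltnP j n; first exact: uy.
by rewrite nth_default ?size_tuple.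
Qed.

Lemma rho_morphism m n : 0 < m ->
  poset_morphism (output_wings (bold m) n) (input_wings (bold m) n) (rho m n).
Proof.
move=> m0; split=> [u Ou|u v Ou Ov uv].
  have [C /word_leP le _] := rhoP m0 Ou.
  apply/input_wingsP => //; split=> // i ni.
  by have := le _ ni; rewrite nth_bump_tail //=; lia.
have [_ _ least] := rhoP m0 Ou; have [C le _] := rhoP m0 Ov.
apply: least => //; apply: le_trans le; apply/word_leP => i ni.
by rewrite !nth_bump_tail // leq_add2l; apply/word_leP.
Qed.

Lemma phi4_isomorphism m n : 0 < m ->
  poset_isomorphism (input_wings (bold m) n) (butterflies (bold m.+1) n)
    (phi4 n).
Proof.
move=> m0.
have order u v : input_wings (bold m) n u -> input_wings (bold m) n v ->
    (u <= v)%O <-> (phi4 n u <= phi4 n v)%O.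
  move=> /(input_wings_increasingP _ m0)[clu incu].
  move=> /(input_wings_increasingP _ m0)[clv incv].
  split=> /word_leP uv; apply/word_leP => -[|i] ni; have := uv _ ni;
    rewrite !nth_phi4 //=; last by have := incu i ni; have := incv i ni; lia.
  + lia.
  + by have := clu 0 ni; lia.
split=> //; split=> [u|u v /set_mem Iu /set_mem Iv uv|v].
- move=> /(input_wings_increasingP _ m0)[cl inc].
  apply/butterfliesP => //; split=> [|i ni|i ni].
  + have [n0|n0] := ltnP 0 n; first by rewrite nth_phi4.
    by rewrite nth_default ?size_tuple.
  + by rewrite nth_phi4 //=; have := cl _ ni; have := inc _ ni; rewrite mulnS; lia.
  + by rewrite !nth_phi4 //=; [have := inc _ ni; have := inc i; lia | lia].
- by apply/le_anti/andP; split; apply/order => //; rewrite uv.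
- move=> /(butterfliesP _ (ltn0Sn m))[v0 bd gap].
  have vi i : i.+1 < n -> i < v`_i.+1.
    elim: i => [|i IH] ni; first by have := bd 0 ni; lia.
    by have := gap i ni; have := IH ltac:(lia); lia.
  (* At i = 0 the truncated i.-1 is 0, so the letter v_0 = 0 is kept. *)
  pose u : word n := [tuple tnth v i - i.-1 | i < n].
  have uE i : i < n -> u`_i = v`_i - i.-1.
    by move=> ni; rewrite nth_mkword (tnth_nth 0).
  exists u.
    apply/input_wings_increasingP => //; split=> -[|i] ni; rewrite !uE //=; try lia.
    + by have := bd i ni; rewrite mulnS; lia.
    + by have := bd 0 ni; lia.
    + by have := gap i ni; have := vi i; lia.
  apply/word_eqP => -[|i] ni; rewrite nth_phi4 //= uE //=.
  by have := vi i ni; lia.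
Qed.

Theorem theorem2p3p11 (m n : nat) (hm : 1 <= m) :
  poset_morphism (output_wings (bold m) n) (input_wings (bold m) n) (rho m n)
  /\
  poset_isomorphism (input_wings (bold m) n) (butterflies (bold m.+1) n) (phi4 n).
Proof. by split; [exact: rho_morphism | exact: phi4_isomorphism]. Qed.
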